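(* Assume Martin's Axiom for $\sigma$-centered partial orderings. Then there is an ultrafilter on $\omega$ that is discrete but is not a $J_\alpha$-ultrafilter for any $\alpha<\omega_1$.
   Context: An ultrafilter $u$ on $\omega$ is discrete if for every $F:\omega\to{}^\omega2$ there is $A\in u$ such that $F(A)$ is a discrete subset of the Cantor space ${}^\omega 2$ (every point of $F(A)$ is isolated in the subspace $F(A)$). For $\alpha\le\omega_1$ let $J_\alpha=\{Y\subseteq\omega_1:\operatorname{tp}Y<\alpha\}$, where $\operatorname{tp}Y$ is the order type of $Y$. An ultrafilter $u$ on $\omega$ is a $J_\alpha$-ultrafilter if for every $F:\omega\to\omega_1$ there is $A\in u$ with $F(A)\in J_\alpha$. Martin's Axiom for $\sigma$-centered partial orderings: for every $\sigma$-centered partial ordering $P$ (a countable union of centered subsets, where a subset is centered if any finitely many of its elements have a common lower bound in $P$) and every family of fewer than $2^{\aleph_0}$ dense subsets of $P$, there is a filter on $P$ meeting all of them. *)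

(* Defs.v *)
From HB Require Import structures.
From mathcomp Require Import all_boot all_order.
From mathcomp Require Import all_classical wochoice all_analysis.
Set Implicit Arguments.
Unset Strict Implicit.
Unset Printing Implicit Defensive.
Import Order.TTheory.
Local Open Scope classical_set_scope.
Local Open Scope card_scope.
Local Open Scope order_scope.

Section MartinAxiom.
Context {d : Order.disp_t} {P : porderType d}.

Definition centered (C : set P) : Prop :=
  forall s : seq P, (forall q, q \in s -> C q) ->
    exists p : P, forall q, q \in s -> p <= q.

Definition sigma_centered : Prop :=
  exists C : nat -> set P,
    (forall n, centered (C n)) /\ \bigcup_n C n = [set: P].

(* Density in the forcing sense, not topological density. *)
Definition dense_below (D : set P) : Prop :=
  forall p : P, exists2 q, D q & q <= p.

(* A filter of the partial order itself; elements of [set_system P] such as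
   [Filter F] are filters of subsets of [P]. *)
Definition poset_filter (G : set P) : Prop :=
  [/\ G !=set0,
      forall p q, G p -> p <= q -> G q &
      forall p q, G p -> G q -> exists2 r, G r & r <= p /\ r <= q].

End MartinAxiom.
Arguments sigma_centered {d} P.

(* Nonemptiness of [P] is the usual convention for forcing notions; the empty
   order has no (nonempty) filter. *)
Definition MA_sigma_centered : Prop :=
  forall (d : Order.disp_t) (P : porderType d),
    inhabited P -> sigma_centered P ->
  forall DD : set (set P),
    DD #<= [set: set nat] -> DD #!= [set: set nat] ->
    (forall D, DD D -> dense_below D) ->
  exists2 G : set P, poset_filter G & forall D, DD D -> G `&` D !=set0.

Definition discrete_subset {T : topologicalType} (S : set T) : Prop :=
  S `<=` isolated S.

Definition discrete_ultrafilter (u : set_system nat) : Prop :=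
  forall F : nat -> cantor_space, exists2 A, u A & discrete_subset (F @` A).

(* [W] has order type omega_1: an uncountable well-order all of whose proper
   initial segments are countable.  A point [a : W] then stands for the
   countable ordinal that is the order type of [[set x | x < a]], and every
   countable ordinal arises from exactly one point. *)
Definition is_omega1 {d : Order.disp_t} (W : orderType d) : Prop :=
  [/\ well_order (<=%O : rel W),
      ~ countable [set: W] &
      forall a : W, countable [set x | x < a]].

Lemma omega1_exists :
  exists (d : Order.disp_t) (W : orderType d), is_omega1 W.
Proof.
have [R Rwo] := well_ordering_principle {classic (set nat)}.
have Rch : wo_chain R predT by move=> A _; exact: Rwo.
have Rtot x y : R x y || R y x by exact: (wo_chainW Rch).
have Rxx x : R x x by exact: (wo_chain_reflexive Rch).
have Ranti x y : R x y && R y x -> x = y by move=> ?; exact: (wo_chain_antisymmetric Rch).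
have Rmin (A : set {classic (set nat)}) : A !=set0 -> exists2 z, A z & forall x, A x -> R z x.
  move=> [x Ax]; have [|z [[zA zm] _]] := Rwo (mem A); first by exists x; rewrite inE.
  by exists z => [|y Ay]; [rewrite -(in_setE A) | apply: zm; apply/mem_set].
have Rtr y x z : R x y -> R y z -> R x z.
  move=> xy yz.
  have [|m [->|[->|->]] mle] := Rmin (fun t => t = x \/ t = y \/ t = z); first by exists x; left.
  - by apply: mle; right; right.
  - have -> : x = y by apply: Ranti; rewrite xy mle //; left.
    by [].
  - have e : y = z by apply: Ranti; rewrite yz mle //; right; left.
    by rewrite -e.
pose I x : set {classic (set nat)} := [set y | R y x /\ y <> x].
have [D [Dunc Dc]] : exists D : set {classic (set nat)}, ~ countable D /\
    forall x, D x -> countable (D `&` I x).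
  have [cI|/existsNP[x0 ncI]] := pselect (forall x, countable (I x)).
    exists setT; split=> [|x _]; last by rewrite setTI.
    move=> /countable_injP[f fi]; pose B : set nat := [set n | exists2 X, f X = n & ~ X n].
    have nB : ~ B (f B).
      move=> /[dup] BB [X fX]; suff -> : X = B by [].
      by apply: fi => //; rewrite inE.
    by apply: (nB); exists B.
  have [|m mU mle] := Rmin (fun x => ~ countable (I x)); first by exists x0.
  exists (I m); split=> // x [xm nxm].
  have cx : countable (I x).
    by apply: contrapT => /mle mx; apply: nxm; apply: Ranti; rewrite xm mx.
  by apply: sub_countable cx; apply: subset_card_le; exact: subIsetr.
pose S := {x : {classic (set nat)} | `[< D x >]}.
pose le (x y : S) := R (val x) (val y).
have le_anti : antisymmetric le by move=> x y /Ranti/val_inj.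
pose PO : porderType Order.default_display := HB.pack S
  (Order.Le_isPOrder.Build Order.default_display S
    (fun x => Rxx (val x)) le_anti (fun y x z => @Rtr (val y) (val x) (val z))).
pose W : orderType Order.default_display := HB.pack S PO
  (Order.POrder_isTotal.Build Order.default_display PO (fun x y => Rtot (val x) (val y))).
exists Order.default_display, W; split.
- move=> A [x Ax].
  have [|z [w Aw wz] zmin] := Rmin [set z | exists2 w : S, w \in A & val w = z].
    by exists (val x); exists x.
  have wmin : minimum_of (<=%O : rel W) A w.
    split=> // y Ay; rewrite /Order.le/= /le wz.
    by apply: zmin; exists y.
  exists w; split=> // w' [Aw' w'min]; apply/le_anti.
  by have := wmin.2 _ Aw'; have := w'min _ Aw; rewrite /Order.le/= => -> ->.
- move=> /countable_injP[f fi]; apply: Dunc; apply/countable_injP.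
  exists (fun x => if pselect (D x) is left Dx then f (exist _ x (asboolT Dx)) else 0%N).
  move=> x y /[!inE] Dx Dy; case: pselect => // Dx'; case: pselect => // Dy' /fi.
  by rewrite !inE => /(_ Logic.I Logic.I) [].
- move=> a; have /countable_injP[f fi] := Dc _ (asboolW (valP a)).
  apply/countable_injP; exists (f \o val) => x y /[!inE] xa ya /= fxy; apply: val_inj.
  have P z : (z < a)%O -> val z \in D `&` I (val a).
    rewrite lt_neqAle inE => /andP[za lez]; split; first exact: asboolW (valP z).
    by split=> [//|/val_inj e]; rewrite e eqxx in za.
  by apply: fi => //; apply: P.
Qed.

Section OrderType.
Context {d : Order.disp_t} {W : orderType d}.

Definition has_order_type (Y : set W) (beta : W) : Prop :=
  exists2 f : W -> W, set_bij Y [set x | x < beta] f &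
    {in Y &, {mono f : x y / x <= y}}.

Definition J (alpha : W) : set (set W) :=
  [set Y | exists2 beta, beta < alpha & has_order_type Y beta].

Definition J_ultrafilter (alpha : W) (u : set_system nat) : Prop :=
  forall F : nat -> W, exists2 A, u A & J alpha (F @` A).

End OrderType.

(* Main.v *)
From HB Require Import structures.
Require Import Defs.
From mathcomp Require Import all_boot all_order.
From mathcomp Require Import all_classical wochoice all_analysis.
Set Implicit Arguments.
Unset Strict Implicit.
Unset Printing Implicit Defensive.
Import Order.TTheory.
Local Open Scope classical_set_scope.
Local Open Scope card_scope.

(** A system assigns to every node [t] of the tree of finite sequences an
  infinite set of successors and a nonempty set [block t] of integers, blocks
  decreasing along successors.  If blocks are contained in cones, the tree of
  successors is a Laver tree each of whose nodes has an extension coded in the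
  root block.  Let [f] be defined block by block, the [n]-th block mapping the
  sequences starting with [n] above all previous blocks and with order types
  cofinal in [a]; by induction on [a], [f] sends every such root block to a set
  of type at least [a].  So it is enough to find a downward directed family of
  systems, maximal, with discrete images for every [F]: maximality lets it
  decide every set at every node, and the root blocks generate an ultrafilter.

  The family is built by recursion on a well-order of type continuum.  Given
  fewer than continuum many systems and [F], a maximal extension of the family
  provides limits [x t] of [F] at every node, with [x (child t n)] close to [x t]
  for infinitely many [n].  Finite approximations to a system whose root block
  has discrete image form a countable forcing notion, and it has dense sets
  ensuring that the generic system meets all the given ones; so Martin's axiom
  for countable orders suffices. *)

(** * Systems *)

Section Systems.
Variables (T : countType) (root : T) (child : T -> nat -> T).

Record system := System { succs : T -> set nat; block : T -> set nat }.

Definition coherent (A : system) :=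
  forall t n, succs A t n -> block A (child t n) `<=` block A t.

Definition good (A : system) := forall t,
  (forall k, exists2 n, (k <= n)%N & succs A t n) /\ block A t !=set0.

Definition sub_system (A B : system) :=
  forall t, succs A t `<=` succs B t /\ block A t `<=` block B t.

Definition meet_system (A B : system) :=
  System (fun t => succs A t `&` succs B t) (fun t => block A t `&` block B t).

Definition base (S : set system) :=
  [/\ S !=set0,
      forall A, S A -> coherent A /\ good A &
      forall A B, S A -> S B -> exists C, [/\ S C, sub_system C A & sub_system C B]].

Definition ultra (M : set system) := base M /\
  forall Z : set nat, exists2 A, M A & forall t, block A t `<=` Z \/ block A t `<=` ~` Z.

Lemma sub_meetl A B : sub_system (meet_system A B) A.
Proof. by move=> t; split=> n []. Qed.

Lemma sub_meetr A B : sub_system (meet_system A B) B.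
Proof. by move=> t; split=> n []. Qed.

Lemma sub_system_trans B A C : sub_system A B -> sub_system B C -> sub_system A C.
Proof.
by move=> AB BC t; have [? ?] := AB t; have [? ?] := BC t; split; apply: subset_trans; eassumption.
Qed.

Lemma sub_meet A B C : sub_system C A -> sub_system C B -> sub_system C (meet_system A B).
Proof.
move=> CA CB t; have [sA bA] := CA t; have [sB bB] := CB t.
by split=> n Cn; split; auto.
Qed.

Lemma meet_coherent A B : coherent A -> coherent B -> coherent (meet_system A B).
Proof.
by move=> cA cB t n [nA nB] s [sA sB]; split; [exact: cA sA|exact: cB sB].
Qed.

Lemma good_sub A B : sub_system A B -> good A -> good B.
Proof.
move=> AB gA t; have [inf [s As]] := gA t; have [sAB bAB] := AB t.
split=> [k|]; last by exists s; exact: bAB.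
by have [n kn /sAB] := inf k; exists n.
Qed.

(** The second clause answers coherence: a block at [t] avoiding [B] in a coherent good system would
    need blocks avoiding [B] at infinitely many successors of [t]. *)
Inductive large (S : set system) (B : set nat) : T -> Prop :=
| large_block A t : S A -> block A t `<=` B -> large S B t
| large_succs A k t : S A ->
    (forall n, succs A t n -> (k <= n)%N -> large S B (child t n)) -> large S B t.

Lemma large_meets S B t A : base S -> large S B t -> S A -> block A t `&` B !=set0.
Proof.
move=> [_ SP dS] lB; elim: lB A => {t} [A' t SA' A'B|A' k t SA' _ IH] A SA.
  have [C [SC CA CA']] := dS _ _ SA SA'.
  have [_ /(_ t)[_ [s Cs]]] := SP _ SC.
  by exists s; split; [exact: (CA t).2|apply/A'B/(CA' t).2].
have [C [SC CA CA']] := dS _ _ SA SA'.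
have [cC /(_ t)[/(_ k)[n kn Cn] _]] := SP _ SC.
have [cA _] := SP _ SA.
have [s [As Bs]] := IH n ((CA' t).1 _ Cn) kn _ SA.
by exists s; split=> //; apply: (cA t n ((CA t).1 _ Cn)).
Qed.

(* It follows [Z] at the nodes where [Z] is compatible with [S], and the
   complement of [Z] at the other nodes. *)
Definition decide (S : set system) (Z : set nat) := System
  (fun t => [set n | large S (~` Z) (child t n) <-> large S (~` Z) t])
  (fun t => [set s | Z s <-> ~ large S (~` Z) t]).

Lemma decide_coherent S Z : coherent (decide S Z).
Proof. by move=> t n /= e s /= Zs; rewrite -e. Qed.

(** Where [large] fails, a lack of successors or of integers would let one of its constructors prove
    it. Where it holds, inverting it gives the successors, and [large_meets] gives the integer. *)
Lemma meet_decide_good S Z A : base S -> S A -> good (meet_system A (decide S Z)).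
Proof.
move=> bS SA; have [_ SP dS] := bS; have [cA gA] := SP _ SA => t.
have [lt|nlt] := pselect (large S (~` Z) t).
  split; last first.
    have [s [As Zs]] := large_meets bS lt SA.
    by exists s; split=> //=; split.
  move=> k; case E: _ / (lt) => [A' t' SA' A'Z|A' k' t' SA' Ch]; subst t'.
    have [C [SC CA CA']] := dS _ _ SA SA'.
    have [cC /(_ t)[/(_ k)[n kn Cn] _]] := SP _ SC.
    exists n => //; split; first exact: (CA t).1.
    split=> // _; apply: (large_block SC).
    by apply: subset_trans A'Z; apply: subset_trans (CA' t).2; exact: cC.
  have [C [SC CA CA']] := dS _ _ SA SA'.
  have [cC /(_ t)[/(_ (maxn k k'))[n]]] := SP _ SC.
  rewrite geq_max => /andP[kn k'n] Cn _.
  exists n => //; split; first exact: (CA t).1.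
  by split=> // _; apply: Ch => //; exact: (CA' t).1.
split=> [k|].
  apply: contrapT => no; apply: (nlt); apply: (@large_succs S _ A k) => // n An kn.
  by apply: contrapT => nl; apply: no; exists n => //; split=> //=; split=> [/nl|/nlt].
apply: contrapT => no; apply: (nlt); apply: (large_block SA) => s As Zs.
by apply: no; exists s; split=> //=; split.
Qed.

Lemma base_adjoin S D : base S -> coherent D ->
  (forall A, S A -> good (meet_system A D)) ->
  base (S `|` [set meet_system A D | A in S]).
Proof.
move=> [[A0 SA0] SP dS] cD gD; split=> [|A|A B].
- by exists A0; left.
- move=> [/SP//|[B SB <-]]; split; last exact: gD.
  by apply: meet_coherent => //; have [] := SP _ SB.
have below X : (S `|` [set meet_system A D | A in S]) X ->
    exists2 Y, S Y & sub_system (meet_system Y D) X.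
  move=> [SX|[Y SY <-]]; first by exists X => //; exact: sub_meetl.
  by exists Y => // t; split.
move=> /below[A' SA' A'A] /below[B' SB' B'B].
have [C [SC CA CB]] := dS _ _ SA' SB'; exists (meet_system C D); split.
- by right; exists C.
- apply: sub_system_trans A'A; apply: sub_meet; last exact: sub_meetr.
  by apply: sub_system_trans CA; exact: sub_meetl.
- apply: sub_system_trans B'B; apply: sub_meet; last exact: sub_meetr.
  by apply: sub_system_trans CB; exact: sub_meetl.
Qed.

Lemma base_ultra S : base S -> exists2 M, S `<=` M & ultra M.
Proof.
(* Zorn's lemma runs over the sets whose union with [S] is a base; the empty chain then has the
   empty set as its union. *)
move=> bS; have [F Fbase Ftot|M [bM Mmax]] :=
    @Zorn_bigcup system (fun M => base (S `|` M)).
  have [[A0 SA0] SP dS] := bS.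
  have chain A B : (S `|` \bigcup_(X in F) X) A -> (S `|` \bigcup_(X in F) X) B ->
      exists Y, [/\ base Y, Y `<=` S `|` \bigcup_(X in F) X, Y A & Y B].
    have up X : F X -> S `|` X `<=` S `|` \bigcup_(X in F) X.
      by move=> FX; apply: setUS; exact: bigcup_sup.
    move=> [SA|[X FX XA]] [SB|[Y FY YB]].
    - by exists S; split=> //; exact: subsetUl.
    - by exists (S `|` Y); split; [exact: Fbase|exact: up|left|right].
    - by exists (S `|` X); split; [exact: Fbase|exact: up|right|left].
    - have [XY|YX] := Ftot _ _ FX FY.
        by exists (S `|` Y); split; [exact: Fbase|exact: up|right; exact: XY|right].
      by exists (S `|` X); split; [exact: Fbase|exact: up|right|right; exact: YX].
  split=> [|A FA|A B FA FB]; first by exists A0; left.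
    by have [Y [[_ YP _] _ /YP]] := chain _ _ FA FA.
  have [Y [[_ _ dY] YF YA YB]] := chain _ _ FA FB.
  by have [C [/YF FC CA CB]] := dY _ _ YA YB; exists C.
exists (S `|` M); first exact: subsetUl.
split=> // Z; set N := S `|` M; pose D := decide N Z.
have bN' : base (N `|` [set meet_system A D | A in N]).
  apply: base_adjoin => // [|A NA]; first exact: decide_coherent.
  exact: meet_decide_good.
have [[A0 NA0] _ _] := bM.
exists (meet_system A0 D); last first.
  move=> t; have [lt|nlt] := pselect (large N (~` Z) t).
    by right=> s [_ /= e] /e.
  by left=> s [_ /= e]; exact/e.
(* By maximality, adjoining all meets with [D] adds nothing new. *)
apply: contrapT => nND.
apply: (Mmax (M `|` [set meet_system A D | A in N])); last by rewrite setUA.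
split; first exact: subsetUl.
by move=> sub; apply: nND; right; apply: sub; right; exists A0.
Qed.
End Systems.

(** * Limits along a maximal family *)

Definition agree (k : nat) (x y : nat -> bool) := forall i, (i < k)%N -> x i = y i.

Lemma agree_sym k x y : agree k x y -> agree k y x.
Proof. by move=> xy i /xy. Qed.

Lemma agree_trans k y x z : agree k x y -> agree k y z -> agree k x z.
Proof. by move=> xy yz i ik; rewrite xy // yz. Qed.

Lemma agreeW k l x y : (k <= l)%N -> agree l x y -> agree k x y.
Proof. by move=> kl xy i ik; apply: xy; exact: leq_trans kl. Qed.

Lemma agree_all x y : (forall k, agree k x y) -> x = y.
Proof. by move=> xy; apply/funext => i; exact: (xy i.+1). Qed.

Lemma agree_separate (I : eqType) (s : seq I) (y : I -> nat -> bool) x :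
  exists k, forall i, i \in s -> agree k (y i) x -> y i = x.
Proof.
elim: s => [|a s [k IH]]; first by exists 0%N.
have [l Hl] : exists l, agree l (y a) x -> y a = x.
  apply: contrapT => /forallNP no; apply: (no 0%N) => _; apply: agree_all => l.
  by apply: contrapT => nl; apply: (no l) => /nl.
exists (maxn k l) => i; rewrite inE => /predU1P[-> /(agreeW (leq_maxr _ _))//|si].
by move=> /(agreeW (leq_maxl _ _)); exact: IH.
Qed.

Lemma agree_nbhs k (x : cantor_space) : nbhs x [set y : cantor_space | agree k y x].
Proof.
elim: k => [|k IH]; first by apply: filterS filterT.
have pk : nbhs x [set y : cantor_space | y k = x k].
  have := @proj_continuous nat (fun=> bool) k x [set x k]; apply.
  by apply: open_nbhs_nbhs; split=> //; exact: discrete_open.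
by apply: filterS2 IH pk => y yx yk i; rewrite ltnS leq_eqVlt => /predU1P[->|/yx].
Qed.

Section Limits.
Variables (T : countType) (child : T -> nat -> T) (M : set (system T)).
Hypothesis ultraM : ultra child M.
Variable F : nat -> cantor_space.

Definition measure_one (t : T) (B : set nat) := exists2 A, M A & block A t `<=` B.

(** The limit of [F] along the ultrafilter of sets of measure one at [t], taken coordinatewise. *)
Definition limit (t : T) : cantor_space := fun i => `[< measure_one t [set s | F s i] >].

Definition constant_at (t : T) := measure_one t [set s | F s = limit t].

Lemma measure_oneI t B C : measure_one t B -> measure_one t C -> measure_one t (B `&` C).
Proof.
have [[_ _ dM] _] := ultraM.
move=> [A MA AB] [A' MA' AC]; have [D [MD DA DA']] := dM _ _ MA MA'.
by exists D => // s Ds; split; [exact/AB/(DA t).2|exact/AC/(DA' t).2].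
Qed.

Lemma measure_one_ex t B : measure_one t B -> B !=set0.
Proof.
have [[_ PM _] _] := ultraM; move=> [A MA AB].
by have [_ /(_ t)[_ [s As]]] := PM _ MA; exists s; exact: AB.
Qed.

Lemma measure_oneVC t B : measure_one t B \/ measure_one t (~` B).
Proof. by have [_ /(_ B)[A MA /(_ t)[]]] := ultraM; [left|right]; exists A. Qed.

Lemma measure_one_child t B : measure_one t B ->
  exists2 A, M A & forall n, succs A t n -> measure_one (child t n) B.
Proof.
have [[_ PM _] _] := ultraM; move=> [A MA AB]; exists A => // n An.
by exists A => //; apply: subset_trans AB; apply: (PM _ MA).1.
Qed.

Lemma measure_one_agree t k : measure_one t [set s | agree k (F s) (limit t)].
Proof.
elim: k => [|k IH].
  by have [[[A MA] _ _] _] := ultraM; exists A.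
have Lk : measure_one t [set s | F s k = limit t k].
  rewrite /limit; case: asboolP => // nk.
  have [//|[A MA AB]] := measure_oneVC t [set s | F s k].
  by exists A => // s /AB /= /negP/negbTE.
have [A MA AB] := measure_oneI IH Lk; exists A => // s /AB[/= sk ek] i.
by rewrite ltnS leq_eqVlt => /predU1P[->//|/sk].
Qed.

(** When [F] is not constant at [t], the equivalence discards the integers mapped exactly to the
    limit, so the limit is approached by other values. *)
Definition near_limit t k s := agree k (F s) (limit t) /\ (F s = limit t <-> constant_at t).

Lemma measure_one_near t k : measure_one t (near_limit t k).
Proof.
have [ct|nct] := pselect (constant_at t).
  have [A MA AB] := measure_oneI (measure_one_agree t k) ct.
  by exists A => // s /AB[sk e]; split=> //; split.
have [//|neq] := measure_oneVC t [set s | F s = limit t].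
have [A MA AB] := measure_oneI (measure_one_agree t k) neq.
by exists A => // s /AB[sk e]; split=> //; split.
Qed.

Lemma block_near A t k : M A -> exists2 s, block A t s & near_limit t k s.
Proof.
move=> MA; have mA : measure_one t (block A t) by exists A.
by have /measure_one_ex[s []] := measure_oneI mA (measure_one_near t k); exists s.
Qed.

(** Sets of measure one at [t] keep measure one at its successors in a suitable system; the two
    limits are then compared through the value of [F] at one integer. *)
Lemma child_near A t k m : M A ->
  exists n, [/\ (m <= n)%N, succs A t n, agree k (limit (child t n)) (limit t) &
    constant_at (child t n) /\ limit (child t n) = limit t <-> constant_at t].
Proof.
move=> MA; have [[_ PM dM] _] := ultraM.
have [B MB BP] := measure_one_child (measure_one_near t k).
have [C [MC CA CB]] := dM _ _ MA MB.
have [_ /(_ t)[/(_ m)[n mn Cn] _]] := PM _ MC.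
have nt := BP _ ((CB t).1 _ Cn).
exists n; split=> //; first exact: (CA t).1.
  have /measure_one_ex[s [[st _] sn]] := measure_oneI nt (measure_one_agree (child t n) k).
  exact: agree_trans (agree_sym sn) st.
split=> [[cn en]|ct].
  have /measure_one_ex[s [[_ <-]]] := measure_oneI nt cn.
  by rewrite /= => ->.
have en : limit (child t n) = limit t.
  apply: agree_all => l.
  have /measure_one_ex[s [[_ [_ /(_ ct) st]]]] :=
    measure_oneI nt (measure_one_agree (child t n) l).
  by rewrite /= st => /agree_sym.
split=> //; rewrite /constant_at en.
by have [A' MA' A'P] := nt; exists A' => // s /A'P[_ /= ->].
Qed.

End Limits.

(** * The generic system *)

(** Fewer than continuum many elements, in a form that transfers along injections. *)
Definition no_continuum {I : Type} (Q : set I) : Prop :=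
  forall f : set nat -> I, (forall X, Q (f X)) -> ~ injective f.

Lemma no_continuum_inj (I K : Type) (Q : set I) (Q' : set K) (h : I -> K) :
  injective h -> (forall i, Q i -> Q' (h i)) -> no_continuum Q' -> no_continuum Q.
Proof.
move=> hinj QQ' nc f fQ finj.
by apply: (nc (h \o f)) => [X|]; [exact/QQ'/fQ|exact: inj_comp].
Qed.

(* Finite sequences ordered by reverse extension are a countable, hence
   sigma-centered, forcing notion. *)
Lemma generic_seq (C : countType) (P : pred (seq C)) (st0 : seq C)
    (I : Type) (Q : set I) (D : I -> set (seq C)) :
  MA_sigma_centered -> P st0 -> no_continuum Q ->
  (forall i p, Q i -> P p -> exists q, [/\ D i q, P q & prefix p q]) ->
  exists G : set (seq C), [/\ forall p, G p -> P p,
    forall p q, G p -> G q -> exists r, [/\ G r, prefix p r & prefix q r] &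
    forall i, Q i -> exists2 p, G p & D i p].
Proof.
move=> hMA P0 Qsmall Ddense.
pose Pos0 := {p : seq C | P p}.
pose le (x y : Pos0) := prefix (val y) (val x).
have le_refl : reflexive le by move=> x; exact: prefix_refl.
have le_anti : antisymmetric le.
  move=> x y /andP[yx xy]; apply: val_inj.
  by move: xy; rewrite /le prefixE take_oversize ?size_prefix // => /eqP.
have le_trans : transitive le by move=> x y z xy yz; exact: prefix_trans yz xy.
pose Pos : porderType Order.default_display := HB.pack Pos0
  (Order.Le_isPOrder.Build Order.default_display Pos0 le_refl le_anti le_trans).
pose D' i : set Pos := [set p | D i (val p)].
have [||||G [_ Gup Gdir] Gmeet] := hMA _ Pos (inhabits (Sub st0 P0)) _ [set D' i | i in Q].
(* Each centered piece contains at most the one sequence with code [n]; [st0] serves for the empty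
   list of elements. *)
- exists (fun n => [set p : Pos | pickle (val p) = n]); split.
    move=> n [_|q s qs]; first by exists (Sub st0 P0).
    exists q => r /qs rn; have qn := qs q (mem_head _ _).
    suff -> : r = q by [].
    by apply/val_inj/(pcan_inj pickleK); rewrite rn qn.
  by apply/seteqP; split=> // p _; exists (pickle (val p)).
- apply/pcard_injP; exists (fun X : set Pos => [set pickle (val p) | p in X]).
  move=> X Y _ _ XY; apply/seteqP; split=> p Xp.
    have : [set pickle (val p) | p in X] (pickle (val p)) by exists p.
    by rewrite XY => -[q Yq /(pcan_inj pickleK)/val_inj <-].
  have : [set pickle (val p) | p in Y] (pickle (val p)) by exists p.
  by rewrite -XY => -[q Yq /(pcan_inj pickleK)/val_inj <-].
(* Choosing an index for each dense set turns an injection of the continuum into the family into one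
   into [Q]. *)
- apply/negP; rewrite card_eqPle => -[_ /pcard_leP/unsquash f].
  have fD X : exists i, Q i /\ D' i = f X.
    have [i Qi fi] : [set D' i | i in Q] (f X) by exact: funS.
    by exists i.
  have [g gf] := boolp.choice fD.
  apply: (Qsmall g) => [X|X Y gXY]; first exact: (gf X).1.
  have [_ eX] := gf X; have [_ eY] := gf Y.
  have fXY : f X = f Y by rewrite -eX -eY gXY.
  by apply: (@inj _ _ _ f) fXY; exact: in_setT.
- move=> _ [i Qi <-] p; have [q [Dq Pq pq]] := Ddense _ _ Qi (valP p).
  by exists (Sub q Pq).
exists [set val p | p in G]; split.
- by move=> _ [p _ <-]; exact: valP.
- move=> _ _ [p Gp <-] [q Gq <-]; have [r Gr [rp rq]] := Gdir _ _ Gp Gq.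
  by exists (val r); split=> //; exists r.
- move=> i Qi; have [|p [Gp Dp]] := Gmeet (D' i); first by exists i.
  by exists (val p) => //; exists p.
Qed.
(* [inl (s, k)] puts [s] into the set under construction and promises that
   no value other than [F s] meets the [k]-th basic neighbourhood of [F s];
   [inr t] promises that the set will be large at the node [t]. *)
Definition command (T : countType) : countType := (nat * nat + T)%type.

(** * Extending a small family by one generic system *)

Section Step.
Variables (T : countType) (root : T) (child : T -> nat -> T).
Variables (S M : set (system T)) (F : nat -> cantor_space).
Hypotheses (S0 : S !=set0) (SM : S `<=` M) (ultraM : ultra child M).

Let x := limit M F.
Let constant := constant_at M F.

Local Notation point s k := (inl (s, k) : command T).
Local Notation node t := (inr t : command T).

(** A node whose limit lies in a neighbourhood reserved for [F s] must be able to supply the value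
    [F s] itself. A constant and a nonconstant node with one limit conflict: the first puts the
    limit into the image, the second makes other values accumulate at it. *)
Definition compatible (c c' : command T) : Prop :=
  match c, c' with
  | inl (s, k), inl (s', _) => agree k (F s') (F s) -> F s' = F s
  | inl (s, k), inr t => agree k (x t) (F s) -> constant t /\ x t = F s
  | inr t, inr r => constant t -> ~ constant r -> x t <> x r
  | inr _, inl _ => True
  end.

Definition condition (p : seq (command T)) :=
  node root \in p /\ forall c c', c \in p -> c' \in p -> compatible c c'.

Lemma condition_rcons p c : condition p -> compatible c c ->
  (forall c', c' \in p -> compatible c c' /\ compatible c' c) ->
  condition (rcons p c).
Proof.
move=> [rp pp] cc cp; split=> [|a b]; first by rewrite mem_rcons inE rp orbT.
rewrite !mem_rcons !inE => /predU1P[->|pa] /predU1P[->|pb] //.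
- exact: (cp b pb).1.
- exact: (cp a pa).2.
- exact: pp.
Qed.

(** At this level, a point near [x t] is near no other limit in [p], and if it falls in a
    neighbourhood reserved in [p], so does [x t]. *)
Lemma separating_level (p : seq (command T)) t : exists k,
  (forall r, node r \in p -> agree k (x r) (x t) -> x r = x t) /\
  (forall s l, point s l \in p -> (l <= k)%N).
Proof.
(* Point commands get the default [x t], for which separation is trivial. *)
pose y (c : command T) : nat -> bool := if c is inr r then x r else x t.
have [k kP] := agree_separate p y (x t).
pose m := (\max_(c <- p) (if c is inl (_, l) then l else 0))%N.
exists (maxn k m); split=> [r rp /(agreeW (leq_maxl _ _))|s l sp]; first exact: kP _ rp.
apply: leq_trans (leq_maxr _ _).
exact: (@leq_bigmax_seq _ _ _ (fun c : command T => if c is inl (_, l) then l else 0)%N _ sp).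
Qed.

(** The value [F s] is taken so near to [x t] that it inherits the compatibilities of [t]; only then
    is its own neighbourhood shrunk to exclude the other values and limits in [p]. *)
Lemma condition_point (p : seq (command T)) t A : condition p -> node t \in p -> M A ->
  exists s k, block A t s /\ condition (rcons p (point s k)).
Proof.
move=> cp tp MA; have [_ pp] := cp; have [k [kx kl]] := separating_level p t.
have [s As [st e]] := block_near ultraM F t k MA.
pose y (c : command T) : nat -> bool := match c with inl (s', _) => F s' | inr r => x r end.
have [l lP] := agree_separate p y (F s).
exists s, l; split=> //; apply: condition_rcons => // -[[s' l']|r] cp'; split=> //=.
- exact: lP _ cp'.
- move=> ss'; have [|ct <-] := pp _ _ cp' tp; last exact/e.
  by apply: agree_trans (agree_sym (agreeW (kl _ _ cp') st)) ss'.
- move=> rs; have xr := lP _ cp' rs; split=> //.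
  have rt : x r = x t by apply: kx => //; rewrite /y in xr; rewrite xr.
  have ct : constant t by apply/e; rewrite -xr.
  by apply: contrapT => nr; apply: (pp _ _ tp cp' ct nr).
Qed.

(** The limit at the child is near [x t], and it can coincide with a limit in [p] only if that limit
    is [x t]; the last clause of [child_near] settles this case. *)
Lemma condition_child (p : seq (command T)) t A m : condition p -> node t \in p -> M A ->
  exists n, [/\ (m <= n)%N, succs A t n & condition (rcons p (node (child t n)))].
Proof.
move=> cp tp MA; have [_ pp] := cp; have [k [kx kl]] := separating_level p t.
have [n [mn An nt e]] := child_near ultraM F t k m MA.
exists n; split=> //.
have xr r : node r \in p -> x (child t n) = x r -> x r = x t.
  by move=> rp er; apply: kx => //; rewrite -er.
apply: condition_rcons => // -[[s l]|r] rp; split=> //=.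
- move=> ns; have [|ct xt] := pp _ _ rp tp.
    by apply: agree_trans (agree_sym (agreeW (kl _ _ rp) nt)) ns.
  by have [cn en] := e.2 ct; split=> //; rewrite /x en.
- move=> cn nr er; have rt := xr _ rp er.
  have ct : constant t by apply/e; split=> //; rewrite -[limit _ _ t]rt -er.
  by apply: (pp _ _ tp rp).
- move=> cr ncn er; have rt := xr _ rp (esym er).
  have [ct|nt'] := pselect (constant t); first by apply: ncn; exact: (e.2 ct).1.
  by apply: (pp _ _ rp tp).
Qed.

Lemma discrete_extension : MA_sigma_centered ->
  no_continuum (S `*` [set: nat]) ->
  exists D, [/\ coherent child D,
    forall A, S A -> good (meet_system A D) & discrete_subset (F @` block D root)].
Proof.
move=> hMA small.
pose Q : set (system T * (T * option nat)) := [set i | S i.1].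
pose goal (i : system T * (T * option nat)) : set (command T) := [set c |
  match i.2.2, c with
  | Some m, inr r => exists n, [/\ (m <= n)%N, succs i.1 i.2.1 n & r = child i.2.1 n]
  | None, inl (s, _) => block i.1 i.2.1 s
  | _, _ => False
  end].
(* The second alternative gives density below conditions with no extension containing the node;
   directedness of [G] refutes it for nodes that do occur in [G]. *)
pose D i : set (seq (command T)) := [set p | (exists2 c, c \in p & goal i c) \/
  forall q, condition q -> prefix p q -> node i.2.1 \notin q].
have c0 : condition [:: node root].
  by split=> [|a b]; rewrite ?inE // => /eqP -> /eqP -> /=.
have smallQ : no_continuum Q.
  apply: (@no_continuum_inj _ _ _ _ (fun i => (i.1, pickle i.2))) small => //.
  by move=> [A i] [B j] [-> /(pcan_inj pickleK) ->].
have [||G [Gc Gdir Gmeet]] :=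
    @generic_seq _ (fun p => `[< condition p >]) [:: node root] _ Q D hMA _ smallQ.
- exact/asboolP.
- move=> [A [t o]] p; rewrite /Q /= => SA /asboolP cp.
  have [[q [cq pq tq]]|no] := pselect (exists q, [/\ condition q, prefix p q & node t \in q]).
    have [c gc cqc] : exists2 c, goal (A, (t, o)) c & condition (rcons q c).
      case: o => [m|].
        have [n [mn An cn]] := condition_child m cq tq (SM SA).
        by exists (inr (child t n)) => //; exists n.
      have [s [k [As cs]]] := condition_point cq tq (SM SA).
      by exists (inl (s, k)).
    exists (rcons q c); split; [|exact/asboolP|exact: prefix_trans pq (prefix_rcons _ _)].
    by left; exists c => //; rewrite mem_rcons mem_head.
  exists p; split; [|exact/asboolP|exact: prefix_refl].
  by right=> q cq pq; apply/negP => tq; apply: no; exists q.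
pose X : set nat := [set s | exists p k, G p /\ point s k \in p].
pose N : set T := [set t | exists2 p, G p & node t \in p].
have sub_prefix (p q : seq (command T)) c : prefix p q -> c \in p -> c \in q.
  by move=> /prefixP[u ->] cp; rewrite mem_cat cp.
have meetN A t o : S A -> N t -> exists c p, [/\ G p, c \in p & goal (A, (t, o)) c].
  move=> SA [q Gq tq]; have [p Gp [[c cp gc]|no]] := Gmeet (A, (t, o)) SA.
    by exists c, p.
  have [r [Gr pr qr]] := Gdir _ _ Gp Gq.
  have /asboolP cr := Gc _ Gr.
  by have := no r cr pr; rewrite (sub_prefix _ _ _ qr tq).
(* Outside [N] the new system imposes no restriction, so goodness there is inherited from [A]. *)
exists (System (fun t => [set n | N t -> N (child t n)]) (fun t => [set s | N t -> X s])).
split.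
- by move=> t n /= Nn s /= NX /Nn.
- move=> A SA t; have [Nt|nN] := pselect (N t); last first.
    have [[_ PM _] _] := ultraM; have [_ /(_ t)[inf [s As]]] := PM _ (SM SA).
    split=> [k|]; last by exists s; split=> // /nN.
    by have [n kn An] := inf k; exists n => //; split=> // /nN.
  split=> [k|].
    have [c [p [Gp]]] := meetN A t (Some k) SA Nt.
    case: c => [_ _ []|r rp [n [kn An en]]].
    by exists n => //; split=> //= _; exists p => //; rewrite -en.
  have [c [p [Gp]]] := meetN A t None SA Nt.
  case: c => [[s k] sp As|_ _ []].
  by exists s; split=> //= _; exists p, k.
- have Nroot : N root.
    have [A SA] := S0; have [p Gp _] := Gmeet (A, (root, None)) SA.
    by exists p => //; have /asboolP[] := Gc _ Gp.
  move=> _ [s Xs <-]; split; first by rewrite inE; exists s.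
  have [p [k [Gp sp]]] := Xs Nroot.
  (* The level [k] promised with [s] isolates [F s]: any other point of the set lies with [s] in a
     common condition. *)
  exists [set y : cantor_space | agree k y (F s)]; first exact: agree_nbhs.
  apply/seteqP; split=> [y [/= ss' [s' Xs' e]]|y -> /=]; last by split; [|exists s].
  subst; have [q [k' [Gq sq]]] := Xs' Nroot.
  have [r [Gr pr qr]] := Gdir _ _ Gp Gq; have /asboolP[_ cr] := Gc _ Gr.
  exact: cr _ _ (sub_prefix _ _ _ pr sp) (sub_prefix _ _ _ qr sq) ss'.
Qed.
End Step.

(** * Maps of large order type *)

Section LargeOrderType.
Local Open Scope order_scope.
Context {d : Order.disp_t} {W : orderType d}.
Hypothesis W1 : is_omega1 W.

Lemma omega1_min (A : set W) : A !=set0 -> exists2 z, A z & forall x, A x -> z <= x.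
Proof.
move=> [x Ax]; have [Wwo _ _] := W1.
have [|z [[zA zm] _]] := Wwo (mem A); first by exists x; rewrite inE.
by exists z => [|y Ay]; [exact: set_mem|apply: zm; apply/mem_set].
Qed.

Lemma omega1_ind (P : W -> Prop) : (forall a, (forall b, b < a -> P b) -> P a) -> forall a, P a.
Proof.
move=> IH a; apply: contrapT => nPa.
have [|z nPz zmin] := @omega1_min (fun x => ~ P x); first by exists a.
apply: nPz; apply: IH => b; apply: contraPP => nPb.
by apply/negP; rewrite -leNgt; exact: zmin.
Qed.

(** Otherwise [W] would be a countable union of countable initial segments and singletons. *)
Lemma omega1_bounded (C : countType) (f : C -> W) : exists b, forall c, f c < b.
Proof.
have [_ unc seg] := W1; apply: contrapT => /forallNP no; apply: unc.
suff -> : [set: W] = \bigcup_(p : C * bool) (if p.2 then [set x | x < f p.1] else [set f p.1]).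
  apply: bigcup_countable; first exact: countableP.
  by move=> [c []] _ //=; exact: seg.
apply/seteqP; split=> // x _; have /existsNP[c /negP] := no x.
rewrite -leNgt le_eqVlt => /predU1P[->|xc]; first by exists (c, false).
by exists (c, true).
Qed.

(* Bounding all late terms keeps every infinite set of indices cofinal. *)
Lemma cofinal_sequence (a x0 : W) : x0 < a ->
  exists e : nat -> W, (forall n, e n < a) /\
    forall x, x < a -> exists n, forall m, (n <= m)%N -> x <= e m.
Proof.
move=> x0a; have [_ _ /(_ a)/countable_injP[i iinj]] := W1.
have /boolp.choice[e eP] n : exists y, y < a /\ forall x, x < a -> (i x < n)%N -> x <= y.
  elim: n => [|n [y [ya yP]]]; first by exists x0.
  have [[z [za zn]]|no] := pselect (exists z, z < a /\ i z = n).
    exists (Order.max y z); split=> [|x xa]; first by rewrite gt_max ya za.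
    rewrite ltnS leq_eqVlt le_max => /predU1P[xn|/(yP _ xa)->//].
    have -> : x = z by apply: iinj; rewrite ?inE// xn.
    by rewrite lexx orbT.
  exists y; split=> // x xa; rewrite ltnS leq_eqVlt => /predU1P[xn|/(yP _ xa)//].
  by case: no; exists x.
exists e; split=> [n|x xa]; first exact: (eP n).1.
by exists (i x).+1 => m im; exact: (eP m).2.
Qed.

(** [P] contains a Laver tree with empty stem; the sequences of [A] extending its nodes may lie
    outside [P]. *)
Definition positive (A : set (seq nat)) := exists P : set (seq nat),
  [/\ P [::],
      forall t, P t -> forall k, exists2 n, (k <= n)%N & P (rcons t n) &
      forall t, P t -> exists2 s, A s & prefix t s].

Lemma positive_ex A : positive A -> A !=set0.
Proof. by move=> [P [P0 _ /(_ _ P0)[s As _]]]; exists s. Qed.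

Lemma positive_child A k : positive A ->
  exists2 n, (k <= n)%N & positive [set s | A (n :: s)].
Proof.
move=> [P [P0 Psucc PA]]; have [n kn Pn] := Psucc _ P0 k.
exists n => //; exists [set t | P (n :: t)]; split=> // [t /Psucc //|t /PA].
by move=> [[|m s] // As] /andP[/eqP -> ts]; exists s.
Qed.

(** Images of type at least [a], expressed by strictly increasing maps [h] so as to avoid ordinal
    arithmetic. The lower bound [g] allows blocks to be stacked. *)
Definition wide (a g : W) (f : seq nat -> W) := (forall s, g < f s) /\
  forall A, positive A -> forall h : W -> W,
  (forall s s', A s -> A s' -> f s < f s' -> h (f s) < h (f s')) ->
  forall x, x < a -> exists2 s, A s & x <= h (f s).

Lemma wide_ex a g : exists f, wide a g f.
Proof.
elim/omega1_ind: a g => a IH g.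
have /boolp.choice[bound boundP] (f : seq nat -> W) : exists b, forall s, f s < b.
  exact: omega1_bounded.
have [[x0 x0a]|no] := pselect (exists x, x < a); last first.
  exists (fun=> bound (fun=> g)); split=> [s|A _ h _ x xa]; last by case: no; exists x.
  exact: (boundP _ [::]).
have [e [ea ecof]] := cofinal_sequence x0a.
have /boolp.choice[f0 f0P] (p : nat * W) : exists f, wide (e p.1) p.2 f by exact: IH.
pose fix start n := if n is m.+1 then bound (f0 (m, start m)) else g.
pose blk n := f0 (n, start n).
have blkS n s : blk n s < start n.+1 by exact: boundP.
have startS n : start n < start n.+1.
  by apply: lt_trans (blkS n [::]); exact: (f0P (n, start n)).1.
have start_mono : {homo start : m n / (m <= n)%N >-> m <= n}.
  by apply: homo_leq => [//|y x z|n]; [exact: le_trans|exact: ltW].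
have blk_lt m n s s' : (m < n)%N -> blk m s < blk n s'.
  move=> mn; apply: lt_le_trans (blkS m s) _; apply: le_trans (start_mono _ _ mn) _.
  exact/ltW/(f0P (n, start n)).1.
exists (fun s => if s is n :: s' then blk n s' else bound (fun=> g)); split.
  move=> [|n s]; first exact: (boundP _ [::]).
  by apply: le_lt_trans (start_mono 0%N n isT) _; exact: (f0P (n, start n)).1.
move=> A Apos h hmono x xa; have [k kP] := ecof _ xa.
have [n kn Anpos] := positive_child k Apos.
(* A point of a later block lies above the whole [n]-th block, on which [h] already reaches every
   value below [e n]; so its [h]-value is at least [e n]. *)
have [m nm Ampos] := positive_child n.+1 Apos.
have [s' As'] := positive_ex Ampos.
exists (m :: s') => //; apply: le_trans (kP _ kn) _; rewrite leNgt; apply/negP => hlt.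
have [s As] := (f0P (n, start n)).2 _ Anpos h
  (fun s s' As As' => hmono (n :: s) (n :: s') As As') _ hlt.
rewrite leNgt => /negP; apply.
exact: (hmono (n :: s) (m :: s') As As' (blk_lt _ _ _ _ nm)).
Qed.

(** An isomorphism onto a type [b] below [a] would be an increasing map with all values below
    [b]. *)
Lemma wide_not_J a g f (A : set (seq nat)) (Y : set W) :
  wide a g f -> positive A -> f @` A `<=` Y -> ~ J a Y.
Proof.
move=> [_ fwide] Apos AY [b ba [h [hfun _ _] hmono]].
have fY s : A s -> Y (f s) by move=> As; apply: AY; exists s.
have [|s As] := fwide _ Apos h _ _ ba; last by rewrite leNgt (hfun _ (fY _ As)).
by move=> s s' As As' ss'; rewrite (leW_mono_in hmono) // inE; exact: fY.
Qed.

End LargeOrderType.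

(** * A well-order with small finite powers *)

Lemma well_order_lt (K : eqType) : exists lt : K -> K -> Prop,
  [/\ well_founded lt, forall y x z, lt x y -> lt y z -> lt x z &
    forall x y, [\/ x = y, lt x y | lt y x]].
Proof.
have [R Rwo] := well_ordering_principle K.
have Rch : wo_chain R predT by move=> A _; exact: Rwo.
have Rtot x y : R x y || R y x by exact: (wo_chainW Rch).
have Ranti x y : R x y -> R y x -> x = y.
  by move=> xy yx; apply: (wo_chain_antisymmetric Rch) => //; rewrite xy yx.
have Rmin (A : set K) : A !=set0 -> exists2 z, A z & forall x, A x -> R z x.
  move=> [x Ax]; have [|z [[zA zm] _]] := Rwo (mem A); first by exists x; rewrite inE.
  by exists z => [|y Ay]; [exact: set_mem|apply: zm; apply/mem_set].
pose lt x y := R x y /\ x <> y.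
have tri x y : [\/ x = y, lt x y | lt y x].
  have [->|/eqP xy] := eqVneq x y; first by constructor 1.
  by have /orP[Rxy|Ryx] := Rtot x y; [constructor 2|constructor 3; split=> // /esym].
have wf : well_founded lt.
  move=> a; apply: contrapT => na.
  have [|z nz zmin] := Rmin (fun x => ~ Acc lt x); first by exists a.
  apply: nz; constructor => y [yz nyz]; apply: contrapT => /zmin zy.
  exact/nyz/Ranti.
exists lt; split=> // y x z [xy nxy] [yz nyz].
(* Transitivity follows from the least element of the three. *)
have [|m [->|[->|->]] mle] := Rmin (fun t => t = x \/ t = y \/ t = z).
- by exists x; left.
- split; first by apply: mle; right; right.
  by move=> xz; subst z; apply: nxy; exact: Ranti.
- by case: nxy; apply: Ranti => //; apply: mle; left.
- by case: nyz; apply: Ranti => //; apply: mle; right; left.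
Qed.

Lemma lex_wf (X A B : Type) (f : X -> A) (g : X -> B)
    (ltA : A -> A -> Prop) (ltB : B -> B -> Prop) :
  well_founded ltA -> well_founded ltB ->
  well_founded (fun x y => ltA (f x) (f y) \/ f x = f y /\ ltB (g x) (g y)).
Proof.
move=> wA wB x; move ea : (f x) => a; move eb : (g x) => b.
elim/(well_founded_ind wA): a b x ea eb => a IHa b.
elim/(well_founded_ind wB): b => b IHb x ea eb.
constructor=> y [|[fxy]]; rewrite ?ea ?eb => ly; first exact: IHa ly _ _ erefl erefl.
by apply: IHb ly _ _ erefl; rewrite fxy.
Qed.

Lemma set_nat_not_inj (f : set nat -> nat) : ~ injective f.
Proof.
move=> finj; pose B : set nat := [set n | exists2 X, f X = n & ~ X n].
have nB : ~ B (f B) by move=> /[dup] BB [X /finj ->].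
by apply: (nB); exists B.
Qed.

Section SmallIndex.
Let K : eqType := {classic (set nat)}.
Variable lt : K -> K -> Prop.
Hypotheses (wf : well_founded lt) (trans : forall y x z, lt x y -> lt y z -> lt x z).
Hypothesis tri : forall x y, [\/ x = y, lt x y | lt y x].

Definition lists_in (D : set K) : set (seq (nat + K)) := [set l | forall y, inr y \in l -> D y].

(* Taking the least segment whose finite lists reach the continuum makes the
   arithmetic of infinite cardinals unnecessary: the recursion runs along the
   lists themselves, ordered first by a bound of their elements. *)
Lemma critical_segment : exists D : set K,
  [/\ D !=set0, ~ no_continuum (lists_in D) &
    forall x, D x -> no_continuum (lists_in [set y | lt y x])].
Proof.
have [small|/existsNP[x0]] := pselect (forall x, no_continuum (lists_in [set y | lt y x])).
  exists setT; split=> [||x _]; [by exists setT| |exact: small].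
  by move=> /(_ (fun X => [:: inr X])); apply=> // X Y [].
elim/(well_founded_ind wf): x0 => x0 IH big.
have [[x [xx0 bigx]]|no] := pselect (exists x, lt x x0 /\
    ~ no_continuum (lists_in [set y | lt y x])); first exact: IH bigx.
exists [set y | lt y x0]; split=> // [|x xx0]; last first.
  by apply: contrapT => bigx; apply: no; exists x.
(* Over an empty segment the lists contain integers only, so they are countable and Cantor's theorem
   applies. *)
apply: contrapT => empty; apply: big => f fx finj.
pose g (z : nat + K) := if z is inl n then n else 0%N.
have gK X : map inl (map g (f X)) = f X.
  rewrite -map_comp map_id_in // => -[//|y] /fx yx0; case: empty; by exists y.
apply: (@set_nat_not_inj (pickle \o map g \o f)) => X Y /(pcan_inj pickleK) gXY.
by apply: finj; rewrite -(gK X) gXY gK.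
Qed.

Lemma lists_in_bounded (D : set K) l : D !=set0 -> lists_in D l ->
  exists2 m, D m & forall y, inr y \in l -> y = m \/ lt y m.
Proof.
move=> [m0 Dm0]; elim: l => [_|[n|x] l IH lD]; first by exists m0.
  have [|m Dm ml] := IH; first by move=> y yl; apply: lD; rewrite inE yl orbT.
  by exists m => // y; rewrite inE => /orP[//|]; exact: ml.
have [|m Dm ml] := IH; first by move=> y yl; apply: lD; rewrite inE yl orbT.
have Dx : D x by apply: lD; exact: mem_head.
have [xm|xm|mx] := tri x m.
- by exists m => // y; rewrite inE => /predU1P[[->]|]; [left|exact: ml].
- by exists m => // y; rewrite inE => /predU1P[[->]|]; [right|exact: ml].
- exists x => // y; rewrite inE => /predU1P[[->]|/ml]; first by left.
  by move=> [->|ym]; right => //; exact: trans mx.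
Qed.

(* Sequences of sequences are coded by one sequence, using their shape; then the
   top element [m] of a closed segment is absorbed among the integers. *)
Definition absorb (m : K) (z : nat + K) : nat + K :=
  match z with inl n => inl n.+1 | inr y => if y == m then inl 0%N else inr y end.

Lemma absorb_inj m : injective (absorb m).
Proof.
move=> [n|y] [n'|y'] /=; [by case=> ->|by case: eqP|by case: eqP|].
by case: eqP => [->|_]; case: eqP => [->|_] // [->].
Qed.

Definition code_list (m : K) (p : seq (K * seq (nat + K)) * nat) : seq (nat + K) :=
  let ll := [seq inr q.1 :: q.2 | q <- p.1] in
  map (absorb m) (inl (pickle (shape ll, p.2)) :: flatten ll).

Lemma code_list_inj m : injective (code_list m).
Proof.
move=> [l n] [l' n'] /(inj_map (@absorb_inj m)) [/(pcan_inj pickleK)[sh ->] fl].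
congr pair; apply: (@inj_map _ _ (fun q : K * seq (nat + K) => inr q.1 :: q.2)).
  by move=> [a b] [a' b'] /= [-> ->].
by rewrite -[LHS]flattenK sh fl flattenK.
Qed.

Lemma code_list_in m p :
  (forall q, q \in p.1 -> forall y, inr y \in inr q.1 :: q.2 -> y = m \/ lt y m) ->
  lists_in [set y | lt y m] (code_list m p).
Proof.
move=> pm y /mapP[[//|z]]; rewrite inE /= => /flattenP[_ /mapP[q qp ->] zq].
by case: eqP => // zm [->]; have [] := pm q qp z zq.
Qed.

End SmallIndex.

(** An index is a list paired with a bound for it in the critical segment. Lists of indices below
    [x] involve only elements up to the bound of [x], hence are coded by lists strictly below that
    bound. *)
Lemma small_index : exists (L : eqType) (lt : L -> L -> Prop) (task : L -> set nat),
  [/\ well_founded lt, forall y x z, lt x y -> lt y z -> lt x z,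
    forall x y, [\/ x = y, lt x y | lt y x],
    forall X, exists l, task l = X &
    forall x, no_continuum [set p : seq L * nat | forall y, y \in p.1 -> lt y x]].
Proof.
pose K : eqType := {classic (set nat)}.
have [lt [wf tr tri]] := well_order_lt K.
have [lt' [wf' tr' tri']] := well_order_lt (seq (nat + K)).
have [D [D0 Dbig Dsmall]] := critical_segment wf.
have [f fD finj] : exists2 f : set nat -> seq (nat + K),
    forall X, lists_in D (f X) & injective f.
  by apply: contrapT => no; apply: Dbig => f fD finj; apply: no; exists f.
pose ok (p : K * seq (nat + K)) := `[< D p.1 /\ lists_in [set y | y = p.1 \/ lt y p.1] p.2 >].
pose L : eqType := {p | ok p}.
pose ltL (x y : L) := lt (val x).1 (val y).1 \/
  (val x).1 = (val y).1 /\ lt' (val x).2 (val y).2.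
have [inv invP] : exists inv : seq (nat + K) -> set nat, forall X, inv (f X) = X.
  exists (fun l => xget set0 [set X | f X = l]) => X.
  by case: xgetP => [Y _ /finj//|/(_ X) []].
exists L, ltL, (fun x => inv (val x).2); split.
- exact: lex_wf.
- move=> y x z [xy|[exy xy]] [yz|[eyz yz]].
  + by left; exact: tr yz.
  + by left; rewrite -eyz.
  + by left; rewrite exy.
  + by right; rewrite exy; split=> //; exact: tr' yz.
- move=> x y; have [e1|l1|l1] := tri (val x).1 (val y).1.
  + have [e2|l2|l2] := tri' (val x).2 (val y).2.
    * constructor 1; apply: val_inj; move: e1 e2.
      by case: (val x) => ? ?; case: (val y) => ? ? /= -> ->.
    * by constructor 2; right.
    * by constructor 3; right.
  + by constructor 2; left.
  + by constructor 3; left.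
- move=> X; have [m Dm mX] := lists_in_bounded tr tri D0 (fD X).
  have okm : ok (m, f X) by apply/asboolP.
  by exists (Sub (m, f X) okm); rewrite /= invP.
- move=> x; have /asboolP[Dx _] := valP x.
  apply: (@no_continuum_inj _ _ _ (lists_in [set y | lt y (val x).1])
    (fun p => code_list (val x).1 (map val p.1, p.2))) (Dsmall _ Dx).
    move=> [l n] [l' n'] /code_list_inj[/(inj_map val_inj) -> ->] //.
  move=> p px; apply: code_list_in => /= _ /mapP[q qp ->] y yq.
  have yq1 : y = (val q).1 \/ lt y (val q).1.
    have /asboolP[_ qP] := valP q.
    by move: yq; rewrite inE => /predU1P[[->]|/qP]; [left|].
  have qx : (val q).1 = (val x).1 \/ lt (val q).1 (val x).1.
    by have [|[]] := px q qp; [right|left].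
  case: yq1 qx => [->|yq1] [<-|qx]; [by left|by right|by right|].
  by right; exact: tr qx.
Qed.

(** * The recursion *)

(** Existence is asked only along the function finally built, so its proof may use, by induction,
    what the earlier values satisfy. *)
Lemma wf_choice (L B : Type) (lt : L -> L -> Prop) (b0 : B) (R : L -> (L -> B) -> B -> Prop) :
  well_founded lt ->
  (forall x g g', (forall y, lt y x -> g y = g' y) -> forall b, R x g b -> R x g' b) ->
  exists A : L -> B, forall x, (exists b, R x A b) -> R x A (A x).
Proof.
move=> wf Rext.
pose extend x (rec : forall y, lt y x -> B) y :=
  if pselect (lt y x) is left yx then rec y yx else b0.
pose F x rec := xget (b0 : {classic B}) [set b | R x (extend x rec) b].
pose A := Fix wf (fun=> {classic B}) F.
have Fext x (g g' : forall y, lt y x -> {classic B}) :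
    (forall y yx, g y yx = g' y yx) -> F x g = F x g'.
  move=> gg'; congr F; apply: functional_extensionality_dep => z.
  by apply: functional_extensionality_dep => zy; exact: gg'.
have AE x : A x = F x (fun y _ => A y) by exact: (Fix_eq wf _ _ Fext x).
have ext x y : lt y x -> extend x (fun z _ => A z) y = A y.
  by rewrite /extend => yx; case: pselect.
exists A => x [b Rb]; rewrite AE; apply: (Rext x (extend x (fun z _ => A z))); first exact: ext.
rewrite /F; case: xgetP => [y _ //|/(_ b)[]].
by apply: Rext Rb => y yx; rewrite ext.
Qed.

Lemma list_max (L : eqType) (lt : L -> L -> Prop) (x0 : L) (l : seq L) :
  (forall y x z, lt x y -> lt y z -> lt x z) ->
  (forall x y, [\/ x = y, lt x y | lt y x]) ->
  exists2 m, m \in x0 :: l & forall y, y \in x0 :: l -> y = m \/ lt y m.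
Proof.
move=> tr tri; elim: l x0 => [|x l IH] x0.
  by exists x0; rewrite ?mem_head // => y; rewrite inE => /eqP; left.
have [m ml mP] := IH x; have [x0m|x0m|mx0] := tri x0 m.
- by exists m; [rewrite inE ml orbT|move=> y; rewrite inE => /predU1P[->|/mP]; [left|]].
- by exists m; [rewrite inE ml orbT|move=> y; rewrite inE => /predU1P[->|/mP]; [right|]].
- exists x0; rewrite ?mem_head // => y; rewrite inE => /predU1P[->|/mP]; first by left.
  by move=> [->|ym]; right => //; exact: tr mx0.
Qed.

(** * Finite meets of systems on finite sequences *)

Definition decode (s : nat) : seq nat := odflt [::] (unpickle s).

Definition cone_system : system (seq nat) :=
  System (fun=> setT) (fun t => [set s | prefix t (decode s)]).

Lemma cone_system_good : good cone_system.
Proof.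
move=> t; split=> [k|]; first by exists k.
by exists (pickle t); rewrite /= /decode pickleK /= prefix_refl.
Qed.

Lemma cone_system_coherent : coherent rcons cone_system.
Proof. by move=> t n _ s /=; apply: prefix_trans; exact: prefix_rcons. Qed.

Section Meets.
Variables (L : eqType) (A : L -> system (seq nat)).

Definition meets (l : seq L) : system (seq nat) :=
  foldr (fun y => meet_system (A y)) cone_system l.

Lemma sub_meets l C : sub_system C cone_system ->
  (forall y, y \in l -> sub_system C (A y)) -> sub_system C (meets l).
Proof.
move=> C0; elim: l => [//|x l IH] Cl /=; apply: sub_meet; first exact/Cl/mem_head.
by apply: IH => y yl; apply: Cl; rewrite inE yl orbT.
Qed.

Lemma meets_sub l : sub_system (meets l) cone_system /\
  forall y, y \in l -> sub_system (meets l) (A y).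
Proof.
elim: l => [|x l [IH0 IH]]; first by split=> // t; split.
split=> [|y] /=; first by apply: sub_system_trans IH0; exact: sub_meetr.
rewrite inE => /predU1P[->|/IH]; first exact: sub_meetl.
by apply: sub_system_trans; exact: sub_meetr.
Qed.

Lemma meets_coherent l : (forall y, y \in l -> coherent rcons (A y)) -> coherent rcons (meets l).
Proof.
elim: l => [_|x l IH cl] /=; first exact: cone_system_coherent.
apply: meet_coherent; first exact/cl/mem_head.
by apply: IH => y yl; apply: cl; rewrite inE yl orbT.
Qed.

Lemma meets_base (Q : L -> Prop) :
  (forall l, (forall y, y \in l -> Q y) -> coherent rcons (meets l) /\ good (meets l)) ->
  base rcons [set meets l | l in [set l | forall y, y \in l -> Q y]].
Proof.
move=> QP; split=> [|_ [l Ql <-]|_ _ [l Ql <-] [l' Ql' <-]]; last 1 first.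
- exists (meets (l ++ l')); have [s0 s] := meets_sub (l ++ l'); split.
  + exists (l ++ l') => // y; rewrite mem_cat => /orP[]; [exact: Ql|exact: Ql'].
  + by apply: sub_meets => // y yl; apply: s; rewrite mem_cat yl.
  + by apply: sub_meets => // y yl; apply: s; rewrite mem_cat yl orbT.
- by exists (meets [::]), [::].
- exact: QP.
Qed.

End Meets.

Lemma eq_meets (L : eqType) (A A' : L -> system (seq nat)) l :
  (forall y, y \in l -> A y = A' y) -> meets A l = meets A' l.
Proof.
elim: l => [//|x l IH] e /=; rewrite e ?mem_head // IH // => y yl.
by apply: e; rewrite inE yl orbT.
Qed.

Lemma discrete_subsetS (X : topologicalType) (B C : set X) :
  B `<=` C -> discrete_subset C -> discrete_subset B.
Proof.
move=> BC dC x Bx; have [_ [V Vx VC]] := dC x (BC _ Bx).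
split; first exact/mem_set.
exists V => //; apply/seteqP; split=> [y [Vy By]|y ->].
  by rewrite -VC; split=> //; exact: BC.
by split=> //; exact: nbhs_singleton.
Qed.

Lemma discrete_family (hMA : MA_sigma_centered) : exists S : set (system (seq nat)),
  [/\ base rcons S, forall A, S A -> sub_system A cone_system &
    forall F : nat -> cantor_space,
      exists2 A, S A & discrete_subset (F @` block A [::])].
Proof.
have [L [lt [task [wf tr tri task_surj small]]]] := small_index.
(* Sets of coded pairs represent all maps into the Cantor space. *)
pose F x : nat -> cantor_space := fun i j => `[< task x (pickle (i, j)) >].
pose R x (A : L -> system (seq nat)) D := [/\ coherent rcons D,
  forall l, (forall y, y \in l -> lt y x) -> good (meet_system (meets A l) D) &
  discrete_subset (F x @` block D [::])].
have [|A AP] := @wf_choice _ _ lt cone_system R wf.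
  move=> x g g' gg' D [cD gD dD]; split=> // l lx.
  by rewrite -(@eq_meets _ g) => [|y /lx/gg' //]; exact: gD.
have meetsP (Q : L -> Prop) : (forall y, Q y -> R y A (A y)) ->
    forall l, (forall y, y \in l -> Q y) -> coherent rcons (meets A l) /\ good (meets A l).
  move=> QR l lQ; split.
    by apply: meets_coherent => y /lQ/QR[].
  case: l lQ => [_|x0 l lQ]; first exact: cone_system_good.
  have [m ml mP] := list_max x0 l tr tri.
  (* With every copy of the greatest index [m] removed, the goodness required of [A m] applies to
     the rest. *)
  pose l' := [seq y <- x0 :: l | y != m].
  have [_ gm _] := QR _ (lQ _ ml).
  have [s0 s] := meets_sub A l'.
  apply: good_sub (gm l' _); last first.
    by move=> y; rewrite mem_filter => /andP[/eqP ym /mP[]].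
  apply: sub_meets => [|y yl].
    by apply: sub_system_trans s0; exact: sub_meetl.
  have [->|ym] := eqVneq y m; first exact: sub_meetr.
  by apply: sub_system_trans (s y _); [exact: sub_meetl|rewrite mem_filter ym].
have RA x : R x A (A x).
  elim/(well_founded_ind wf): x => x IH; apply: AP.
  have bS := @meets_base L A (fun y => lt y x) (@meetsP (fun y => lt y x) IH).
  have [M SM uM] := base_ultra bS.
  have [S0 _ _] := bS.
  have [|D [cD gD dD]] := discrete_extension [::] (F x) S0 SM uM hMA.
    (* Choosing a list for each meet reduces the smallness of the family to that of the lists below
       [x]. *)
    move=> f fS finj.
    have /boolp.choice[g gP] X : exists l, (forall y, y \in l -> lt y x) /\ meets A l = (f X).1.
      by have [[l lx e] _] := fS X; exists l.
    apply: (small x (fun X => (g X, (f X).2))) => [X|X Y [gXY fXY]]; first exact: (gP X).1.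
    apply: finj; rewrite [f X]surjective_pairing [f Y]surjective_pairing.
    by rewrite -(gP X).2 -(gP Y).2 gXY fXY.
  by exists D; split=> // l lx; apply: gD; exists l.
exists [set meets A l | l in [set l | forall y, y \in l -> True]]; split.
- by apply: meets_base; exact: meetsP.
- by move=> _ [l _ <-]; exact: (meets_sub A l).1.
- move=> G; have [x xG] := task_surj [set n | if unpickle n is Some (i, j) then G i j else false].
  have FG : F x = G.
    apply/funext => i; apply/funext => j; rewrite /F xG /= pickleK /=.
    by case: (G i j); [exact/asboolP|exact/asboolPn].
  exists (meets A [:: x]); first by exists [:: x].
  have [_ _] := RA x; rewrite FG; apply: discrete_subsetS.
  by apply: image_subset => s [].
Qed.

(** * The ultrafilter of root blocks *)

Lemma ultra_UltraFilter (T : countType) (child : T -> nat -> T) M t :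
  ultra child M -> UltraFilter (measure_one M t).
Proof.
move=> uM; have [[[A0 MA0] _ _] _] := uM.
have pM : ProperFilter (measure_one M t).
  apply: Build_ProperFilter_ex => [B mB|]; first by have [s] := measure_one_ex uM mB; exists s.
  split=> [|B C|B C BC [A MA AB]]; first by exists A0.
    exact: (measure_oneI uM).
  by exists A => //; exact: subset_trans BC.
split=> // G pG MG; apply/seteqP; split=> // B GB.
have [//|/MG GBC] := measure_oneVC uM t B.
by have /filter_ex[s []] : G (B `&` ~` B) by exact: filterI.
Qed.

Theorem theorem4p13 (d : Order.disp_t) (omega1 : orderType d)
    (homega1 : is_omega1 omega1) (hMA : MA_sigma_centered) :
  exists u : set_system nat,
    [/\ UltraFilter u,
        discrete_ultrafilter u &
        forall alpha : omega1, ~ J_ultrafilter alpha u].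
Proof.
have [S [bS Scone Sdiscrete]] := discrete_family hMA.
have [M SM uM] := base_ultra bS; have [[_ PM dM] _] := uM.
exists (measure_one M [::]); split; first exact: ultra_UltraFilter uM.
  move=> F; have [A SA dA] := Sdiscrete F.
  by exists (block A [::]) => //; exists A => //; exact: SM.
move=> alpha Ju; have [f f_wide] := wide_ex homega1 alpha alpha.
have [A [B MB BA]] := Ju (f \o decode).
have [[C0 SC0] _ _] := bS.
(* Refining a member of the discrete family as well puts the blocks of [C] inside cones. *)
have [C [MC CB CC0]] := dM _ _ MB (SM _ SC0).
have [cC gC] := PM _ MC.
have Ccone := sub_system_trans CC0 (Scone _ SC0).
apply: (wide_not_J f_wide (A := [set decode s | s in block C [::]])).
  (* Coherence keeps successors in this set, and any integer of [block C t] decodes to an extension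
     of [t]. *)
  exists [set t | block C t `<=` block C [::]]; split=> //= t Ct.
    move=> k; have [/(_ k)[n kn Cn] _] := gC t.
    by exists n => //; apply: subset_trans Ct; exact: cC.
  have [_ [s Cs]] := gC t; exists (decode s); first by exists s => //; exact: Ct.
  exact: (Ccone t).2.
by move=> _ [_ [s Cs <-] <-]; exists s => //; apply/BA/(CB [::]).2.
Qed.
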